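(* Let $1\le k\le n$ be integers, let $E\subseteq\mathbb{R}^n$, and let $F$ denote the union of $E$ with every $k$-plane $V\subseteq\mathbb{R}^n$ such that $V\cap E$ has positive $k$-dimensional Lebesgue measure. Then either $E=F$, or $$\dim_H(F)\leq 2\dim_H(E)-k.$$
   Context: A $k$-plane is a $k$-dimensional affine subspace of $\mathbb{R}^n$ (not necessarily through the origin). ''Positive measure'' for a subset of a $k$-plane $V$ means that it is measurable with positive measure with respect to $k$-dimensional Lebesgue measure on $V\cong\mathbb{R}^k$. $\dim_H$ denotes Hausdorff dimension. The set $E$ itself is arbitrary. *)

(* Defs.v *)
(* MathComp / MathComp-Analysis; R^n is the type 'rV[R]_n of row vectors over
   an arbitrary R : realType. *)
From HB Require Import structures.
From mathcomp Require Import all_boot all_order all_algebra.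
From mathcomp Require Import all_classical all_reals all_analysis.

Set Implicit Arguments.
Unset Strict Implicit.
Unset Printing Implicit Defensive.
Import Order.TTheory GRing.Theory Num.Theory.
Local Open Scope classical_set_scope.
Local Open Scope ring_scope.

(* The library norm `|x| on 'rV[R]_n is the sup norm, hence this one. *)
Definition enorm (R : realType) (n : nat) (x : 'rV[R]_n) : R :=
  Num.sqrt (\sum_(j < n) x ord0 j ^+ 2).

Section Hausdorff.
Variables (R : realType) (n : nat).
Implicit Types (A U : set 'rV[R]_n) (s delta : R).
Local Open Scope ereal_scope.

(* diam set0 = -oo. *)
Definition diam A : \bar R :=
  ereal_sup [set (enorm (p.1 - p.2)%R)%:E | p in A `*` A].

(* For s = 0 a nonempty set has weight 1, as 0 `^ 0 = 1. *)
Definition hausdorff_weight s U : \bar R :=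
  if U == set0 then 0 else poweR (diam U) s.

Definition hausdorff_premeasure s delta A : \bar R :=
  ereal_inf [set \sum_(i <oo) hausdorff_weight s (U i) |
    U in [set U : (set 'rV[R]_n)^nat |
      (forall i, diam (U i) <= delta%:E) /\ A `<=` \bigcup_i U i]].

Definition hausdorff_measure s A : \bar R :=
  ereal_sup [set hausdorff_premeasure s delta A | delta in [set d : R | (0 < d)%R]].

(* The empty set gets dimension 0. *)
Definition hausdorff_dim A : \bar R :=
  ereal_inf [set s%:E | s in [set s : R | (0 <= s)%R /\ hausdorff_measure s A = 0]].

End Hausdorff.

Section Lebesgue.
Variables (R : realType) (k : nat).
Implicit Types (a b : 'rV[R]_k) (A : set 'rV[R]_k).
Local Open Scope ereal_scope.

Definition cbox a b : set 'rV[R]_k :=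
  [set x | forall j, (a ord0 j <= x ord0 j <= b ord0 j)%R].

Definition cbox_volume a b : R := (\prod_(j < k) (b ord0 j - a ord0 j))%R.

(* The k-dimensional Lebesgue outer measure, for k > 0; the index U i is the
   pair of extreme corners of a (possibly degenerate) closed box. *)
Definition lebesgue_outer A : \bar R :=
  ereal_inf [set \sum_(i <oo) (cbox_volume (U i).1 (U i).2)%:E |
    U in [set U : nat -> 'rV[R]_k * 'rV[R]_k |
      (forall i j, ((U i).1 ord0 j <= (U i).2 ord0 j)%R) /\
      A `<=` \bigcup_i cbox (U i).1 (U i).2]].

Definition pos_lebesgue A : Prop :=
  lebesgue_outer.-caratheodory A /\ 0 < lebesgue_outer A.

End Lebesgue.

Section Planes.
Variables (R : realType) (n k : nat).
Implicit Types (V A E : set 'rV[R]_n).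

Definition kplane V : Prop :=
  exists (a : 'rV[R]_n) (W : {vspace 'rV[R]_n}),
    \dim W = k /\ V = [set x | x - a \in W].

(* When the rows of B are orthonormal this is a Euclidean isometry of R^k onto
   a k-plane through a. *)
Definition plane_param (a : 'rV[R]_n) (B : 'M[R]_(k, n)) (v : 'rV[R]_k) :
  'rV[R]_n := a + v *m B.

(* Lebesgue measure on the k-plane V is transported from R^k along an isometric
   affine parametrization of V. Two such parametrizations differ by a rigid
   motion of R^k, so the choice does not matter. *)
Definition pos_measure_in V A : Prop :=
  exists (a : 'rV[R]_n) (B : 'M[R]_(k, n)),
    [/\ B *m B^T = 1%:M,
        range (plane_param a B) = V
      & pos_lebesgue (plane_param a B @^-1` A)].

Definition plane_extension E : set 'rV[R]_n :=
  E `|` \bigcup_(V in [set V | kplane V /\ pos_measure_in V (V `&` E)]) V.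

End Planes.

(* Main.v *)
(* Idea.  Fix s with H^s(E) = 0 and cover E at every dyadic scale d = 2^-l by
   about d^-s sets of diameter at most d.  If x lies on a k-plane V meeting E in
   positive measure, pigeonholing over the scales gives a scale at which the part
   of E covered by the sets of that scale still meets V in measure at least
   a = c th^l, with th < 1 as boxclose to 1 as we please.  That part contains about
   a d^-k points of V separated by d.  They lie in O(d^(1-k)) tubes of width d
   through x, so by Cauchy-Schwarz about a^2 d^(-k-1) pairs of them are in a common
   tube and at mutual distance at least a constant times a; distinct pairs lie in
   distinct pairs of covering sets.  Conversely, a pair of covering sets at that
   distance leaves for x only a neighbourhood of width O(d/a) of a segment, hence
   O(1/d) choices separated by d, up to powers of a.  Double counting gives at most
   d^(-2s) d^-1 / d^(-k-1) = d^(k-2s) such x, up to powers of a, and summing over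
   the scales yields H^t = 0 for every t > 2s - k.  Only the countable
   subadditivity of the outer measures is used. *)
Require Import Defs.
From mathcomp Require Import all_boot all_order all_algebra.
From mathcomp Require Import all_classical all_reals all_analysis.
From mathcomp Require Import ring lra zify.

Set Implicit Arguments.
Unset Strict Implicit.
Unset Printing Implicit Defensive.
Import Order.TTheory GRing.Theory Num.Theory.
Local Open Scope classical_set_scope.
Local Open Scope ring_scope.

(** * Separated sets *)

Section Bins.
Variable R : realType.
Implicit Types h x y D : R.

(** As [Num.truncn] sends negative reals to 0, every quantity binned below is first shifted to be
    nonnegative. *)
Definition bin h x : nat := Num.truncn (x / h).

Lemma ltn_bin h x D : 0 < h -> x <= D -> (bin h x < (bin h D).+1)%N.
Proof. by move=> h0 xD; rewrite ltnS le_truncn// ler_pM2r ?invr_gt0. Qed.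

Lemma bin_itv h x : 0 < h -> 0 <= x ->
  (bin h x)%:R * h <= x < (bin h x)%:R * h + h.
Proof.
move=> h0 x0; have /truncn_itv/andP[] : 0 <= x / h by rewrite divr_ge0// ltW.
by rewrite ler_pdivlMr// ltr_pdivrMr// -natr1 mulrDl mul1r => -> ->.
Qed.

Lemma bin_inj h x y : 0 < h -> 0 <= x -> 0 <= y -> bin h x = bin h y ->
  `|x - y| < h.
Proof.
move=> h0 x0 y0 e; have := bin_itv h0 x0; have := bin_itv h0 y0.
by rewrite -e ltr_distl; set t := _ * h; move=> /andP[? ?] /andP[? ?]; apply/andP;
    split; lra.
Qed.

Lemma binS_le h D : 0 < h -> 0 <= D -> (bin h D).+1%:R <= D / h + 1.
Proof. by move=> h0 D0; rewrite -natr1 lerD2r truncn_le divr_ge0// ltW. Qed.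

End Bins.

Section Scattered.
Variables (X : eqType) (r : rel X).
Hypotheses (rxx : reflexive r) (rC : symmetric r).

(** Used with [boxclose d] for separated nets, and with [eq_op] to list a set of indices of bounded
    cardinality. *)
Definition scattered (s : seq X) : Prop :=
  uniq s /\ {in s &, forall x y, r x y -> x = y}.

(** Take a scattered list of greatest length: a point of [A] related to none of its members could be
    prepended. *)
Lemma maximal_scattered (A : set X) (N : nat) :
  (forall s, scattered s -> (forall x, x \in s -> A x) -> (size s <= N)%N) ->
  exists s, [/\ scattered s, forall x, x \in s -> A x &
    forall x, A x -> exists2 y, y \in s & r x y].
Proof.
move=> AN.
pose P m := `[< exists s, [/\ scattered s, (forall x, x \in s -> A x) & size s = m] >].
have exP : exists m, P m by exists 0%N; apply/asboolP; exists [::].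
have ubP m : P m -> (m <= N)%N by move=> /asboolP[s [ss sA <-]]; exact: AN.
case: (ex_maxnP exP ubP) => m /asboolP[s [[us ss] sA sm]] mmax.
exists s; split => // x Ax.
apply: contrapT => nx; suff : (m.+1 <= m)%N by rewrite ltnn.
have far y : y \in s -> ~~ r x y by move=> ys; apply/negP => xy; apply: nx; exists y.
apply: mmax; apply/asboolP; exists (x :: s); split; last by rewrite /= sm.
- split => /=; first by rewrite us andbT; apply/negP => /far; rewrite rxx.
  move=> u v; rewrite !inE => /predU1P[->|us'] /predU1P[->|vs] // uv.
  + by have := far _ vs; rewrite uv.
  + by have := far _ us'; rewrite rC uv.
  + exact: ss.
- by move=> y; rewrite inE => /predU1P[->//|/sA].
Qed.

End Scattered.

Section Separated.
Variables (R : realType) (n : nat).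
Implicit Types (x y : 'rV[R]_n) (d : R).

(** Closeness in the sup norm: its balls are boxes, so a maximal separated list yields a cover by
    boxes of side [2 * d]. *)
Definition boxclose d x y : bool := [forall j, `|x ord0 j - y ord0 j| <= d].

Definition boxseparated d (s : seq 'rV[R]_n) : Prop := scattered (boxclose d) s.

Lemma boxcloseP d x y : reflect (forall j, `|x ord0 j - y ord0 j| <= d) (boxclose d x y).
Proof. exact: forallP. Qed.

Lemma boxclosexx d : 0 <= d -> reflexive (boxclose d).
Proof. by move=> d0 x; apply/boxcloseP => j; rewrite subrr normr0. Qed.

Lemma boxcloseC d : symmetric (boxclose d).
Proof. by move=> x y; apply/boxcloseP/boxcloseP => H j; rewrite distrC. Qed.

End Separated.

(** * Tubes through a point *)

(** Cauchy-Schwarz for the sizes [q t] of the fibres, whose squares add up to the number of pairs in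
    a common fibre. *)
Lemma card_same_fiber (J T : finType) (f : J -> T) :
  (#|J| ^ 2 <= #|T| * #|[set p : J * J | f p.1 == f p.2]%SET|)%N.
Proof.
pose q t := #|[set j | f j == t]%SET|.
have q1 : (\sum_t q t = #|J|)%N.
  rewrite -sum1_card (partition_big f xpredT) //=; apply: eq_bigr => t _.
  by rewrite sum1dep_card.
have q2 : (\sum_t q t ^ 2 = #|[set p : J * J | f p.1 == f p.2]%SET|)%N.
  rewrite -sum1dep_card -(pair_big_dep xpredT (fun i j => f i == f j) (fun _ _ =>
      1%N)) /=.
  rewrite [RHS](partition_big f xpredT) //=; apply: eq_bigr => t _.
  rewrite (eq_bigr (fun=> q t)) => [|i /eqP fi]; last first.
    by rewrite sum1dep_card fi; apply: eq_card => j; rewrite !inE eq_sym.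
  by rewrite sum_nat_const -mulnn /q cardsE.
(* Both sides are doubled, so that the inequality between [2 * (q t * q u)] and [q t ^ 2 + q u ^ 2]
   can be summed over all pairs of fibres. *)
rewrite -(leq_pmul2l (ltn0Sn 1)) -q2 -q1 -mulnn big_distrl big_distrr /=.
apply: (@leq_trans (\sum_t \sum_u (q t ^ 2 + q u ^ 2))).
  apply: leq_sum => t _; rewrite !big_distrr /=; apply: leq_sum => u _.
  exact: nat_Cauchy.
under eq_bigr do rewrite big_split /= sum_nat_const.
by rewrite big_split /= sum_nat_const -big_distrr /= mul2n addnn.
Qed.

Section Tubes.
Variables (R : realType) (k : nat).
Implicit Types (v w : 'rV[R]_k.+1) (h d : R).

Definition dirmax v : 'I_k.+1 := [arg max_(l > ord0) `|v ord0 l| ]%O.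

Lemma dirmaxP v c : `|v ord0 c| <= `|v ord0 (dirmax v)|.
Proof. by rewrite /dirmax; case: arg_maxP => // l _; apply. Qed.

Definition slope v j : R := v ord0 (lift (dirmax v) j) / v ord0 (dirmax v) + 1.

Lemma slope_itv v j : 0 <= slope v j <= 2.
Proof.
have : `|v ord0 (lift (dirmax v) j) / v ord0 (dirmax v)| <= 1.
  rewrite normf_div; have [->|v0] := eqVneq (v ord0 (dirmax v)) 0.
    by rewrite normr0 invr0 mulr0.
  by rewrite ler_pdivrMr ?normr_gt0// mul1r dirmaxP.
by rewrite ler_norml /slope => /andP[? ?]; apply/andP; split; lra.
Qed.

(* Tubes of relative width h through the origin, indexed by the direction of
   a dominant coordinate and the discretized slopes of the other ones. *)
Definition tube h v : 'I_k.+1 * {ffun 'I_k -> 'I_(bin h 2).+1} :=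
  (dirmax v, [ffun j => inord (bin h (slope v j))]).

(** The left side is a 2 by 2 minor; divided by the two dominant coordinates it is a difference of
    slopes in one cell. The form without division also covers zero vectors. *)
Lemma tube_collinear h v w c : 0 < h -> tube h v = tube h w ->
  `|v ord0 c * w ord0 (dirmax v) - w ord0 c * v ord0 (dirmax v)| <=
  h * `|v ord0 (dirmax v)| * `|w ord0 (dirmax v)|.
Proof.
move=> h0 [evw /ffunP eb]; have mv := dirmaxP v; have mw := dirmaxP w.
have sv := slope_itv v; have sw := slope_itv w.
have Hs j : `|slope v j - slope w j| < h.
  have /andP[v1 v2] := sv j; have /andP[w1 w2] := sw j.
  apply: bin_inj => //; have := congr1 val (eb j); rewrite !ffunE /=.
  by rewrite !inordK ?ltn_bin.
rewrite /slope -evw in mw Hs; set l := dirmax v in mv mw Hs *.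
have h1 : 0 <= h * `|v ord0 l| * `|w ord0 l| by rewrite !mulr_ge0 // ltW.
have [v0|v0] := eqVneq (v ord0 l) 0.
  have := mv c; rewrite v0 normr0 normr_le0 => /eqP ->.
  by rewrite mul0r mulr0 subrr normr0 mulr0 mul0r.
have [w0|w0] := eqVneq (w ord0 l) 0.
  have := mw c; rewrite w0 normr0 normr_le0 => /eqP ->.
  by rewrite mul0r mulr0 subrr normr0 mulr0.
case: (unliftP l c) => [j|] ->; last by rewrite mulrC subrr normr0.
rewrite -mulrA -normrM.
rewrite (_ : _ - _ = (v ord0 (lift l j) / v ord0 l +
    1 - (w ord0 (lift l j) / w ord0 l + 1)) * (v ord0 l * w ord0 l));
    last by field; rewrite v0 w0.
by rewrite [leLHS]normrM ler_wpM2r // ltW.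
Qed.

Lemma tube_dist h v w c : 0 < h -> tube h v = tube h w ->
  `|v ord0 c - w ord0 c| <=
  `|v ord0 (dirmax v) - w ord0 (dirmax v)| + h * `|v ord0 (dirmax v)|.
Proof.
move=> h0 tvw; have := tube_collinear c h0 tvw.
have evw := congr1 fst tvw; rewrite /= in evw.
have mv := dirmaxP v c; have := dirmaxP w c; rewrite -evw.
set l := dirmax v in mv *; move=> mw H.
have [w0|w0] := eqVneq (w ord0 l) 0.
  move: mw; rewrite w0 normr0 normr_le0 => /eqP ->; rewrite !subr0.
  by rewrite (le_trans mv) // lerDl mulr_ge0 // ltW.
rewrite -(@ler_pM2r _ `|w ord0 l|) ?normr_gt0 // -normrM.
rewrite (_ : _ * w ord0 l = (v ord0 c * w ord0 l - w ord0 c * v ord0 l) +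
    w ord0 c * (v ord0 l - w ord0 l)); last by ring.
rewrite (le_trans (ler_normD _ _)) // mulrDl addrC lerD // normrM mulrC ler_wpM2l //.
Qed.

(* Points of one tube that are separated are separated in the dominant
   coordinate, so each has few neighbours; the rest is Cauchy-Schwarz. *)
Lemma many_far_pairs (p : nat) (v : 'I_p -> 'rV[R]_k.+1) (d r b h : R) :
  0 < d -> d <= r -> 0 < b ->
  (forall i j, boxclose d (v i) (v j) -> i = j) ->
  (forall i c, `|v i ord0 c| <= b) ->
  h * b = d / 2 ->
  p%:R ^+ 2 <=
  (k.+1 * (bin h 2).+1 ^ k)%:R *
  (#|[set q : 'I_p * 'I_p | (tube h (v q.1) == tube h (v q.2)) &&
      (r <= `|v q.2 ord0 (dirmax (v q.1)) - v q.1 ord0 (dirmax (v q.1))|)]%SET|%:R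
   + p%:R * (5 * r / d)).
Proof.
move=> d0 dr b0 sep bnd hb.
have h0 : 0 < h by rewrite -(pmulr_lgt0 _ b0) hb divr_gt0.
have := card_same_fiber (fun i => tube h (v i)).
rewrite card_prod card_ffun !card_ord -(ler_nat R) natrX => /le_trans; apply.
rewrite natrM ler_wpM2l //.
set A := [set q | _ == _]%SET; set B := [set q | _ && _]%SET.
have AE : (#|A| <= #|B| + #|A :\: B|)%N.
  by rewrite -(cardsID B A) leq_add2r subset_leq_card // subsetIr.
apply: (@le_trans _ _ (#|B| + #|A :\: B|)%:R); first by rewrite ler_nat.
rewrite natrD lerD2l.
have d2 : 0 < d / 2 by rewrite divr_gt0.
(* The number of cells of length [d / 2] in an interval of length [2 * r]; it will bound the near
   partners of one point inside its tube. *)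
pose K := (bin (d / 2) (2 * r)).+1.
have KE : K%:R <= 5 * r / d.
  rewrite (le_trans (binS_le _ _)) //; first by lra.
  rewrite (_ : 2 * r / (d / 2) = 4 * r / d); last by field; rewrite gt_eqF.
  have rd : 1 <= r / d by rewrite ler_pdivlMr ?mul1r.
  lra.
apply: (@le_trans _ _ (p * K)%:R); last by rewrite natrM ler_wpM2l.
rewrite ler_nat.
pose x (q : 'I_p * 'I_p) := v q.2 ord0 (dirmax (v q.1)) - v q.1 ord0 (dirmax (v q.1)) + r.
pose g (q : 'I_p * 'I_p) : 'I_p * 'I_K := (q.1, inord (bin (d / 2) (x q))).
have xb q : q \in A :\: B -> tube h (v q.1) = tube h (v q.2) /\ 0 <= x q <= 2 * r.
  rewrite !inE /= => /andP[+ /eqP tq]; rewrite tq eqxx /= -ltNge ltr_norml /x.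
  by move=> /andP[? ?]; split => //; apply/andP; split; lra.
(* Two partners of one point in the same cell differ by less than [d / 2] in the dominant
   coordinate, hence by at most [d] in all, by [tube_dist] and [h * b = d / 2]; separation
   identifies them. *)
have ginj : {in A :\: B &, injective g}.
  move=> [i j] [i' j'] /xb/= [t1 /andP[l1 u1]] /xb/= [t2 /andP[l2 u2]] [ei].
  move=> /(congr1 val); rewrite /= !inordK ?ltn_bin // => /(bin_inj d2 l1 l2).
  subst i'; rewrite /x /= => le1; congr pair; apply: sep; apply/boxcloseP => c.
  have t12 : tube h (v j) = tube h (v j') by rewrite -t1.
  have em : dirmax (v j) = dirmax (v i) by move/(congr1 fst): t1.
  rewrite (le_trans (tube_dist c h0 t12)) // em.
  have : h * `|v j ord0 (dirmax (v i))| <= d / 2.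
    by rewrite -hb ler_wpM2l // ltW.
  move: le1; rewrite (_ : _ - _ = v j ord0 (dirmax (v i)) - v j' ord0 (dirmax (v i))).
    lra.
  ring.
rewrite -(card_in_imset ginj) (leq_trans (max_card _)) //.
by rewrite card_prod !card_ord.
Qed.
End Tubes.

(** * Points nearly collinear with two small sets *)

Section Enorm.
Variable R : realType.

Lemma enorm_sqr (m : nat) (x : 'rV[R]_m) : enorm x ^+ 2 = (x *m x^T) ord0 ord0.
Proof.
rewrite sqr_sqrtr; last by apply: sumr_ge0 => j _; rewrite sqr_ge0.
by rewrite mxE; apply: eq_bigr => j _; rewrite mxE expr2.
Qed.

Lemma enorm_ge0 (m : nat) (x : 'rV[R]_m) : 0 <= enorm x.
Proof. exact: sqrtr_ge0. Qed.

Lemma coord_le_enorm (m : nat) (x : 'rV[R]_m) j : `|x ord0 j| <= enorm x.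
Proof.
rewrite -(@ler_pXn2r _ 2) ?nnegrE ?enorm_ge0 // enorm_sqr mxE.
rewrite real_normK ?num_real // (bigD1 j) //= mxE -expr2 lerDl.
by apply: sumr_ge0 => i _; rewrite mxE -expr2 sqr_ge0.
Qed.

Lemma enorm_le (m : nat) (x : 'rV[R]_m) e :
  (forall j, `|x ord0 j| <= e) -> enorm x <= m%:R * e.
Proof.
case: m x => [|m] x H; first by rewrite /enorm big_ord0 sqrtr0 mul0r.
have e0 : 0 <= e := le_trans (normr_ge0 _) (H ord0).
rewrite -(@ler_pXn2r _ 2) ?nnegrE ?enorm_ge0 ?mulr_ge0 //.
rewrite enorm_sqr mxE exprMn; apply: (@le_trans _ _ (\sum_(j < m.+1) e ^+ 2)).
  apply: ler_sum => j _; rewrite mxE -expr2 -real_normK ?num_real //.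
  by rewrite lerXn2r ?nnegrE.
rewrite sumr_const card_ord -[leLHS]mulr_natl ler_wpM2r ?sqr_ge0 //.
by rewrite -natrX ler_nat -mulnn leq_pmulr.
Qed.

End Enorm.

Section Orthonormal.
Variables (R : realType) (k n : nat) (B : 'M[R]_(k, n)).
Hypothesis BB : B *m B^T = 1%:M.

Lemma enorm_isometry (v : 'rV[R]_k) : enorm (v *m B) = enorm v.
Proof.
apply: (@pexpIrn _ 2) => //; rewrite ?nnegrE ?enorm_ge0 //.
by rewrite !enorm_sqr trmx_mul mulmxA -(mulmxA v) BB mulmx1.
Qed.

Lemma orthonormal_coord (v : 'rV[R]_k) e c : (forall j, `|v ord0 j| <= e) ->
  `|(v *m B) ord0 c| <= k%:R * e.
Proof.
by move=> H; rewrite (le_trans (coord_le_enorm _ _))// enorm_isometry enorm_le.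
Qed.

End Orthonormal.

Section Linked.
Variables (R : realType) (n : nat).
Implicit Types (x y z : 'rV[R]_n) (A : set 'rV[R]_n) (d : R).

(** The bounds [t] and [w] confine the nearby point of the line to a segment of bounded length; it
    may lie outside the stretch from [y] to [z]. *)
Definition linked (t e w : R) A A' x : Prop :=
  exists y z (s : R), [/\ A y, A' z, `|s| <= t,
    forall c, `|z ord0 c - y ord0 c| <= w &
    forall c, `|x ord0 c - (y ord0 c + s * (z ord0 c - y ord0 c))| <= e].

(** As [A] and [A'] are small, one segment serves all points; the cell of the parameter along it and
    the cells of the offsets from it determine the point. *)
Lemma separated_linked_size (t e w d : R) A A' (s : seq 'rV[R]_n) :
  0 < d -> 0 <= t -> 0 <= e -> 0 <= w ->
  (forall y y', A y -> A y' -> boxclose d y y') ->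
  (forall y y', A' y -> A' y' -> boxclose d y y') ->
  boxseparated d s -> (forall x, x \in s -> linked t e w A A' x) ->
  (size s <= (bin d (2 * t)).+1 *
             (bin d (2 * (e + d * (1 + 2 * t) + d * w))).+1 ^ n)%N.
Proof.
move=> d0 t0 e0 w0 dA dA' [us ss] ls.
set D := e + _ + _; have D0 : 0 <= D by rewrite !addr_ge0 ?mulr_ge0 ?addr_ge0 ?mulr_ge0
    // ltW.
case: s => [|x0 s'] in us ss ls *; first by [].
set s := x0 :: s' in us ss ls *.
have [y0 [z0 [_ [Ay0 Az0 _ w00 _]]]] := ls x0 (mem_head _ _).
(* Passing from the pair linked to [x] to the reference pair [y0], [z0] costs [d] for [y] and at
   most [t * d] for each of the two terms with the parameter. *)
have /choice[f fP] : forall x, exists u : R, x \in s -> `|u| <= t /\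
    forall c, `|x ord0 c - (y0 ord0 c + u * (z0 ord0 c - y0 ord0 c))| <= e + d * (1 +
        2 * t).
  move=> x; have [xs|] := boolP (x \in s); last by exists 0.
  have [y [z [u [Ay Az ut _ H]]]] := ls x xs; exists u => _; split => // c.
  have /boxcloseP/(_ c) h1 := dA _ _ Ay Ay0; have /boxcloseP/(_ c) h2 := dA' _ _ Az Az0.
  rewrite (_ : _ - _ = (x ord0 c - (y ord0 c + u * (z ord0 c - y ord0 c))) +
    ((y ord0 c - y0 ord0 c) + (u * (z ord0 c - z0 ord0 c) - u *
        (y ord0 c - y0 ord0 c)))); last by ring.
  rewrite (le_trans (ler_normD _ _)) // lerD //.
  rewrite (le_trans (ler_normD _ _)) // [leRHS](_ : _ = d + d * (2 * t)) ?lerD //;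
      last by ring.
  rewrite (le_trans (ler_normB _ _)) // !normrM.
  have a1 : `|u| * `|z ord0 c - z0 ord0 c| <= t * d by rewrite ler_pM.
  have a2 : `|u| * `|y ord0 c - y0 ord0 c| <= t * d by rewrite ler_pM.
  lra.
pose b x := bin d (f x + t).
(* The parameter rounded down to its cell. The error of at most [d] moves the point by at most
   [d * w], the last summand of [D]. *)
pose u x := (b x)%:R * d - t.
pose X x c := x ord0 c - (y0 ord0 c + u x * (z0 ord0 c - y0 ord0 c)) + D.
pose g x : 'I_(bin d (2 * t)).+1 * {ffun 'I_n -> 'I_(bin d (2 * D)).+1} :=
  (inord (b x), [ffun c => inord (bin d (X x c))]).
have fb x : x \in s -> 0 <= f x + t <= 2 * t.
  by move=> /fP[+ _]; rewrite ler_norml => /andP[? ?]; apply/andP; split; lra.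
have Xb x c : x \in s -> 0 <= X x c <= 2 * D.
  move=> xs; have [ft /(_ c) H] := fP x xs.
  have /andP[fx0 fx1] := fb x xs.
  have /andP[b1 b2] := bin_itv d0 fx0.
  have uf : `|f x - u x| <= d by rewrite ler_norml /u /b; apply/andP; split; lra.
  have : `|x ord0 c - (y0 ord0 c + u x * (z0 ord0 c - y0 ord0 c))| <= D.
    rewrite (_ : _ - _ = x ord0 c - (y0 ord0 c + f x * (z0 ord0 c - y0 ord0 c)) +
        (f x - u x) * (z0 ord0 c - y0 ord0 c)); last by ring.
    rewrite (le_trans (ler_normD _ _)) // lerD // normrM.
    by rewrite ler_pM.
  by rewrite ler_norml /X => /andP[? ?]; apply/andP; split; lra.
have ginj : {in s &, injective g}.
  move=> x x' xs xs' [/(congr1 val) e1 /ffunP e2].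
  have /andP[? ?] := fb x xs; have /andP[? ?] := fb x' xs'.
  rewrite /= !inordK ?ltn_bin // in e1.
  apply: ss => //; apply/boxcloseP => c.
  have /andP[l1 ?] := Xb x c xs; have /andP[l2 ?] := Xb x' c xs'.
  have := congr1 val (e2 c); rewrite !ffunE /= !inordK ?ltn_bin // => /(bin_inj d0 l1 l2).
  rewrite /X /u e1 => /ltW; rewrite (_ : _ - _ = x ord0 c - x' ord0 c) //.
  ring.
rewrite -(size_map g).
have /card_uniqP <- : uniq (map g s) by rewrite map_inj_in_uniq.
by rewrite (leq_trans (max_card _)) // card_prod card_ffun !card_ord.
Qed.

End Linked.

(** This is [many_far_pairs] with [x] as origin and [h = d / (2 * b)]: separated samples lie in
    distinct sets [U i], and the line through two far samples of one tube passes near [x]. *)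
Lemma many_linked_pairs (R : realType) (n k p N : nat) (B : 'M[R]_(k.+1, n))
    (x : 'rV[R]_n) (v : 'I_p -> 'rV[R]_k.+1) (U : 'I_N -> set 'rV[R]_n) (d r b : R) :
  0 < d -> d <= r -> 0 < b -> B *m B^T = 1%:M ->
  (forall i j, boxclose d (v i) (v j) -> i = j) ->
  (forall i c, `|v i ord0 c| <= b) ->
  (forall i y y', U i y -> U i y' -> enorm (y - y') <= d) ->
  (forall j, exists i, U i (x + v j *m B)) ->
  p%:R ^+ 2 <=
  (k.+1 * (bin (d / (2 * b)) 2).+1 ^ k)%:R *
  (#|[set q : 'I_N * 'I_N | `[< linked (b / r) (k.+1%:R * (d * b / (2 * r)))
      (2 * k.+1%:R * b) (U q.1) (U q.2) x >] ]%SET|%:R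
   + p%:R * (5 * r / d)).
Proof.
move=> d0 dr b0 BB sep bnd dU /choice[f fP].
have hb : d / (2 * b) * b = d / 2 by field; rewrite gt_eqF.
have h0 : 0 < d / (2 * b) by rewrite divr_gt0 // mulr_gt0.
have r0 : 0 < r by exact: lt_le_trans dr.
have := many_far_pairs d0 dr b0 sep bnd hb; set h := d / (2 * b) in hb h0 *.
move=> /le_trans; apply; rewrite ler_wpM2l // lerD2r ler_nat.
have finj : injective f.
  move=> i j fij; apply: sep; apply/boxcloseP => c.
  have := dU _ _ _ (fP i); rewrite fij => /(_ _ (fP j)).
  rewrite opprD addrACA subrr add0r -mulmxBl enorm_isometry //.
  by apply: le_trans; have := coord_le_enorm (v i - v j) c; rewrite !mxE.
pose g (q : 'I_p * 'I_p) := (f q.1, f q.2).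
have ginj : injective g by move=> [i j] [i' j'] [/finj-> /finj->].
rewrite -(card_imset _ ginj) subset_leq_card //; apply/fintype.subsetP =>
    _ /imsetP[[i j] + ->].
rewrite !inE /= => /andP[/eqP tij far].
set l := dirmax (v i) in far.
pose a := v j ord0 l - v i ord0 l.
have a0 : 0 < `|a| by exact: lt_le_trans far.
(* The parameter at which the dominant coordinate vanishes on the line through [v i] and [v j]. The
   other coordinates there are minors divided by [a], small by [tube_collinear]. *)
exists (x + v i *m B), (x + v j *m B), (- v i ord0 l / a); split.
- exact: fP.
- exact: fP.
- by rewrite normf_div normrN ler_pM ?invr_ge0 // ?lef_pV2 ?posrE.
- move=> c.
  rewrite (_ : _ - _ = ((v j - v i) *m B) ord0 c); last by rewrite mulmxBl !mxE; ring.
  rewrite [leRHS](_ : _ = k.+1%:R * (2 * b)); last by ring.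
  apply: orthonormal_coord => // j'.
  by rewrite !mxE (le_trans (ler_normB _ _)) // mulr_natl lerD.
- move=> c.
  rewrite (_ : _ - _ = (- (v i + (- v i ord0 l / a) *: (v j - v i)) *m B) ord0 c);
      last first.
    by rewrite mulNmx mulmxDl -scalemxAl mulmxBl !mxE; ring.
  apply: orthonormal_coord => //.
  move=> c'; rewrite !mxE normrN.
  have an0 : a != 0 by rewrite -normr_gt0.
  have -> : v i ord0 c' + - v i ord0 l / a * (v j ord0 c' - v i ord0 c') =
    (v i ord0 c' * v j ord0 l - v j ord0 c' * v i ord0 l) / a.
    by rewrite /a in an0 *; field.
  have := tube_collinear c' h0 tij; rewrite -/l => H1.
  rewrite normf_div invfM mulrA ler_pM ?invr_ge0 // ?lef_pV2 ?posrE //.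
  rewrite (le_trans H1) // [leRHS](_ : _ = h * b * b); last by rewrite hb; ring.
  have h0' := ltW h0.
  by apply: ler_pM => //; [exact: mulr_ge0 | exact: ler_wpM2l].
Qed.

(** * Double counting of points against pairs of covering sets *)

Lemma double_counting (R : realType) (X : eqType) (T : finType) (P : X -> T -> bool)
    (s : seq X) (Q : R) (L : nat) :
  (forall x, x \in s -> Q <= #|[set q | P x q]%SET|%:R) ->
  (forall q, (count (P^~ q) s <= L)%N) ->
  (size s)%:R * Q <= (#|T| * L)%:R.
Proof.
move=> Qs Ls; apply: (@le_trans _ _ (\sum_(x <- s) #|[set q | P x q]%SET|)%:R).
  rewrite natr_sum; apply: (@le_trans _ _ (\sum_(x <- s) Q)).
    by rewrite big_const_seq count_predT iter_addr_0 mulr_natl.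
  by rewrite [leLHS]big_seq [leRHS]big_seq; apply: ler_sum.
rewrite ler_nat; under eq_bigr do rewrite -sum1dep_card big_mkcond.
rewrite exchange_big /= -sum_nat_const; apply: leq_sum => q _.
by rewrite -big_mkcond sum1_count.
Qed.

(** Each rich point is linked to at least [a ^+ 2 / (C0 * d ^+ k.+2)] pairs of sets, and each pair
    to at most [L1 / (r ^+ n.+1 * d)] points with [r] proportional to [a]. Hence the exponent
    [n + 3]. *)
Lemma few_rich_points (R : realType) (n k : nat) (b : R) : 1 <= b ->
  exists c C : R, [/\ 0 < c, c <= 1, 0 < C & 
  forall (d a : R) (N : nat) (U : 'I_N -> set 'rV[R]_n) (s : seq 'rV[R]_n),
  0 < d -> d <= c * a -> a <= 1 ->
  (forall i y y', U i y -> U i y' -> enorm (y - y') <= d) ->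
  boxseparated d s ->
  (forall x, x \in s -> exists p (v : 'I_p -> 'rV[R]_k.+1) (B : 'M[R]_(k.+1, n)),
    [/\ B *m B^T = 1%:M, forall i j, boxclose d (v i) (v j) -> i = j,
     forall i c, `|v i ord0 c| <= b, forall j, exists i, U i (x + v j *m B) &
     a <= p%:R * (2 * d) ^+ k.+1]) ->
  (size s)%:R * a ^+ (n + 3) <= C * N%:R ^+ 2 * d ^+ k.+1].
Proof.
move=> b1; have b0 : 0 < b by lra.
(* [M1 / d ^+ k] bounds the number of tubes: each of the [k] slopes has at most [5 * b / d]
   cells. *)
pose M1 : R := k.+1%:R * (5 * b) ^+ k.
have M1_ge1 : 1 <= M1 by rewrite mulr_ege1 ?ler1n // exprn_ege1 //; lra.
(* Chosen so that [M1 * (5 * r) = a / (2 * 2 ^+ k.+1)] for [r = c * a], which lets the near pairs be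
   absorbed. *)
pose c : R := (10 * 2 ^+ k.+1 * M1)^-1.
have M10 : 0 < M1 by lra.
have c0 : 0 < c by rewrite invr_gt0 mulr_gt0 // mulr_gt0 // exprn_gt0.
have c1 : c <= 1.
  rewrite invf_le1; last by rewrite -invr_gt0.
  by rewrite mulr_ege1 // mulr_ege1 ?exprn_ege1 ?ler1n.
pose C0 : R := 2 * M1 * 4 ^+ k.+1.
have C00 : 0 < C0 by rewrite mulr_gt0 ?exprn_gt0 // mulr_gt0.
(* The parameter has at most [3 * b / (r * d)] cells, each of the [n] offsets at most
   [b * (5 * k.+1%:R + 7) / r]. *)
pose L1 : R := 3 * b * (b * (5 * k.+1%:R + 7)) ^+ n.
have L10 : 0 < L1.
  by rewrite mulr_gt0 ?mulr_gt0 // exprn_gt0 // mulr_gt0 // addr_gt0 // mulr_gt0.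
exists c, (L1 * C0 / c ^+ n.+1); split => //.
  by apply: divr_gt0; [exact: mulr_gt0 | exact: exprn_gt0].
move=> d a N U s d0 dca a1 dU ss rich.
pose r := c * a.
have a0 : 0 < a by rewrite -(pmulr_rgt0 _ c0) (lt_le_trans d0).
have r0 : 0 < r by rewrite mulr_gt0.
have r1 : r <= 1 by rewrite mulr_ile1 // ltW.
have d1 : d <= 1 by exact: le_trans r1.
pose t := b / r; pose e := k.+1%:R * (d * b / (2 * r)); pose w := 2 * k.+1%:R * b.
have t0 : 0 < t by rewrite divr_gt0.
have e0 : 0 < e by rewrite mulr_gt0 // divr_gt0 // mulr_gt0.
have w0 : 0 < w by rewrite !mulr_gt0.
pose P x (q : 'I_N * 'I_N) := `[< linked t e w (U q.1) (U q.2) x >].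
pose K2 := (bin d (2 * (e + d * (1 + 2 * t) + d * w))).+1.
pose K1 := (bin d (2 * t)).+1.
have dUc i y y' : U i y -> U i y' -> boxclose d y y'.
  move=> Uy Uy'; apply/boxcloseP => j; rewrite (le_trans _ (dU i y y' Uy Uy')) //.
  by have := coord_le_enorm (y - y') j; rewrite !mxE.
have lowQ x : x \in s -> a ^+ 2 / (C0 * d ^+ k.+2) <= #|[set q | P x q]%SET|%:R.
  move=> /rich[p [v [B [BB sep bnd vU ap]]]].
  have := many_linked_pairs d0 dca b0 BB sep bnd dU vU.
  rewrite -/r -/t -/e -/w; set Q := (X in X + _).
  have -> : Q = #|[set q | P x q]%SET|%:R by [].
  rewrite {}/Q; set Q := #|_|%:R; set M := (X in X * _) => H.
  have Q0 : 0 <= Q by [].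
  have MD : M * d ^+ k <= M1.
    rewrite /M natrM natrX -mulrA -exprMn ler_wpM2l //.
    apply: lerXn2r; rewrite ?nnegrE; [by rewrite mulr_ge0 // ltW|lra|].
    rewrite -ler_pdivlMr // (le_trans (binS_le _ _)) ?divr_gt0 ?mulr_gt0 //.
    rewrite (_ : 2 / (d / (2 * b)) = 4 * b / d); last by field; rewrite !gt_eqF.
    have : 1 <= b / d by rewrite ler_pdivlMr // mul1r; exact: le_trans b1.
    lra.
  set D := d ^+ k in MD; have D0 : 0 < D by rewrite exprn_gt0.
  rewrite exprMn (exprS d) -/D in ap; set T := 2 ^+ k.+1 in ap.
  have T0 : 0 < T by rewrite exprn_gt0.
  have cE : M1 * (5 * r) = a / (2 * T).
    by rewrite /r /c -/T; field; rewrite !gt_eqF.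
  have p0 : 0 <= p%:R :> R by [].
  have H1 : p%:R ^+ 2 * (D * d) <= M1 * Q * d + p%:R * (M1 * (5 * r)).
    apply: (@le_trans _ _ (M * (Q + p%:R * (5 * r / d)) * (D * d))).
      by rewrite ler_wpM2r // mulr_ge0 // ltW.
    rewrite [leLHS](_ : _ = M * D * (Q * d + p%:R * (5 * r)));
        last by field; rewrite gt_eqF.
    rewrite [leRHS](_ : _ = M1 * (Q * d + p%:R * (5 * r))); last by ring.
    by rewrite ler_wpM2r // addr_ge0 ?mulr_ge0 // ltW.
  (* The lower bound [ap] on [p] makes the near pairs at most half of the left side of [H1]. *)
  have H2 : p%:R * (M1 * (5 * r)) <= p%:R ^+ 2 * (D * d) / 2.
    rewrite cE [leRHS](_ : _ = p%:R * (p%:R * (T * (d * D)) / (2 * T)));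
        last by field; rewrite gt_eqF.
    by rewrite ler_wpM2l // ler_wpM2r // invr_ge0 mulr_ge0 // ltW.
  have H3 : p%:R ^+ 2 * (D * d) <= 2 * (M1 * Q * d) by lra.
  have E4 : 4 ^+ k.+1 = T ^+ 2 :> R by rewrite /T -exprM mulnC exprM; congr (_ ^+ _);
      ring.
  rewrite ler_pdivrMr; last by apply: mulr_gt0 => //; exact: exprn_gt0.
  apply: (@le_trans _ _ ((p%:R * (T * (d * D))) ^+ 2)).
    by apply: lerXn2r => //; rewrite nnegrE; [exact: ltW | rewrite !mulr_ge0 // ltW].
  rewrite [leLHS](_ : _ = p%:R ^+ 2 * (D * d) * (T ^+ 2 * (D * d))); last by ring.
  rewrite [leRHS](_ : _ = 2 * (M1 * Q * d) * (T ^+ 2 * (D * d)));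
      last by rewrite /C0 E4 !(exprS d) -/D; ring.
  by rewrite ler_wpM2r // !mulr_ge0 ?exprn_ge0 // ltW.
have upL q : (count (P^~ q) s <= K1 * K2 ^ n)%N.
  rewrite -size_filter; apply: (@separated_linked_size _ _ t e w d (U q.1) (U q.2)) =>
      //; try exact: ltW.
  - by move=> y y'; apply: dUc.
  - by move=> y y'; apply: dUc.
  - split; first by rewrite filter_uniq; case: ss.
    by move=> y z; rewrite !mem_filter => /andP[_ xs] /andP[_ ys]; apply: ss.2.
  - by move=> y; rewrite mem_filter => /andP[/asboolP].
have := double_counting lowQ upL; rewrite card_prod !card_ord => H.
have K1b : K1%:R * (r * d) <= 3 * b.
  rewrite -ler_pdivlMr ?mulr_gt0 //.
  apply: le_trans (binS_le _ _) _ => //; first by rewrite mulr_ge0 // ltW.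
  rewrite /t (_ : 2 * (b / r) / d = 2 * b / (r * d)); last by field; rewrite !gt_eqF.
  have : 1 <= b / (r * d).
    by rewrite ler_pdivlMr ?mulr_gt0 // mul1r (le_trans _ b1) // mulr_ile1 // ltW.
  lra.
have K2b : K2%:R * r <= b * (5 * k.+1%:R + 7).
  rewrite -ler_pdivlMr //; apply: le_trans (binS_le _ _) _ => //.
    apply/ltW/mulr_gt0 => //; apply: addr_gt0; last exact: mulr_gt0.
    by apply: addr_gt0 => //; apply: mulr_gt0 => //; apply: addr_gt0 =>
        //; exact: mulr_gt0.
  rewrite /e /t /w (_ : 2 * _ / d = b / r * k.+1%:R + 2 + 4 * (b / r) +
      4 * k.+1%:R * b); last by field; rewrite !gt_eqF.
  have br1 : 1 <= b / r by rewrite ler_pdivlMr // mul1r (le_trans r1).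
  have bbr : b <= b / r by rewrite ler_pdivlMr // ler_piMr // ltW.
  have : k.+1%:R * b <= k.+1%:R * (b / r) by rewrite ler_wpM2l.
  rewrite [b * _ / r](_ : _ = 5 * (k.+1%:R * (b / r)) + 7 * (b / r));
      last by field; rewrite gt_eqF.
  rewrite [b / r * k.+1%:R]mulrC; lra.
have H1 : (K1 * K2 ^ n)%:R * (r ^+ n.+1 * d) <= L1.
  have E (u z : R) : u * z ^+ n * (r ^+ n.+1 * d) = u * (r * d) * (z * r) ^+ n.
    by rewrite [(z * r) ^+ n]exprMn (exprS r); ring.
  rewrite natrM natrX E.
  apply: ler_pM => //.
  - by rewrite !mulr_ge0 // ltW.
  - by rewrite exprn_ge0 // mulr_ge0 // ltW.
  - by rewrite lerXn2r // nnegrE !(mulr_ge0, addr_ge0) // ltW.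
have rn0 : 0 < c ^+ n.+1 by rewrite exprn_gt0.
have dk0 : 0 < d ^+ k.+1 by rewrite exprn_gt0.
have -> : (size s)%:R * a ^+ (n + 3) =
   (size s)%:R * (a ^+ 2 / (C0 * d ^+ k.+2)) *
       (r ^+ n.+1 * d * C0 * d ^+ k.+1 / c ^+ n.+1).
  rewrite addn3 !exprS /r !exprMn; field.
  by rewrite !gt_eqF ?exprn_gt0.
apply: (@le_trans _ _ ((N * N * (K1 * K2 ^ n))%:R *
    (r ^+ n.+1 * d * C0 * d ^+ k.+1 / c ^+ n.+1))).
  apply: ler_wpM2r => //; apply/ltW/divr_gt0 => //; apply: mulr_gt0 => //.
  by apply: mulr_gt0 => //; apply: mulr_gt0 => //; exact: exprn_gt0.
rewrite natrM [leLHS](_ : _ = (K1 * K2 ^ n)%:R * (r ^+ n.+1 * d) *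
    ((N * N)%:R * C0 * d ^+ k.+1 / c ^+ n.+1)); last by ring.
rewrite [leRHS](_ : _ = L1 * ((N * N)%:R * C0 * d ^+ k.+1 / c ^+ n.+1));
    last by rewrite natrM; ring.
apply: ler_wpM2r => //; apply: divr_ge0; last exact: ltW.
by apply: mulr_ge0; [apply: mulr_ge0 => // |]; exact: ltW.
Qed.

(** * Outer measures defined by countable covers *)

Lemma nneseries_geometric_le (R : realType) (C q : R) : 0 <= C -> 0 <= q < 1 ->
  (\sum_(i <oo) (C * q ^+ i)%:E <= (C / (1 - q))%:E)%E.
Proof.
move=> C0 /andP[q0 q1].
apply: lime_le; first by apply: is_cvg_nneseries =>
    i _ _; rewrite lee_fin mulr_ge0 // exprn_ge0.
near=> N; rewrite sumEFin lee_fin.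
have -> : \sum_(0 <= i < N) C * q ^+ i = series (geometric C q) N by [].
have q1' : 0 <= (1 - q)^-1 by rewrite invr_ge0 subr_ge0 ltW.
rewrite geometric_seriesE ?lt_eqF //= ler_wpM2r //.
by rewrite ler_piMr // lerBlDr lerDl exprn_ge0.
Unshelve. all: by end_near. Qed.

Section CoverOuter.
Variables (R : realType) (T I : Type) (cov : I -> set T) (w : I -> \bar R).
Variable P : set I.
Hypothesis w_ge0 : forall i, P i -> (0 <= w i)%E.
Implicit Types A B : set T.
Local Open Scope ereal_scope.

(** Common form of [hausdorff_premeasure], with [cov := id], and of [lebesgue_outer], with boxes and
    their volumes. *)
Definition cover_outer A : \bar R :=
  ereal_inf [set \sum_(i <oo) w (u i) |
    u in [set u : nat -> I | (forall i, P (u i)) /\ A `<=` \bigcup_i cov (u i)]].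

Lemma cover_outer_ge0 A : 0 <= cover_outer A.
Proof. by apply: le_ereal_inf_tmp => _ [u [Pu _] <-]; apply: nneseries_ge0 =>
    n _ _; exact: w_ge0. Qed.

Lemma le_cover_outer A B : A `<=` B -> cover_outer A <= cover_outer B.
Proof.
move=> AB; apply: ereal_inf_le_tmp => _ [u [Pu Bu] <-]; exists u => //.
by split => //; exact: subset_trans Bu.
Qed.

Lemma cover_outer_bigcup (F : nat -> set T) :
  cover_outer (\bigcup_i F i) <= \sum_(i <oo) cover_outer (F i).
Proof.
(* Near-optimal covers are available only for finite values, so an infinite term is treated
   apart. *)
have [[i Foo]|noo] := pselect (exists i, cover_outer (F i) = +oo).
  by rewrite (eseries_pinfty _ _ Foo) ?leey // =>
      j _; rewrite gt_eqF // (lt_le_trans _ (cover_outer_ge0 _)).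
apply/lee_addgt0Pr => e e0.
apply: le_trans (epsilon_trick xpredT _ (ltW e0));
    last by move=> n; exact: cover_outer_ge0.
have /choice[G PG] n : exists u : nat -> I, [/\ forall i, P (u i),
    F n `<=` \bigcup_i cov (u i) &
    \sum_(i <oo) w (u i) <= cover_outer (F n) + (e / (2 ^ n.+1)%:R)%:E].
  have fin : cover_outer (F n) \is a fin_num.
    rewrite fin_numElt (lt_le_trans _ (cover_outer_ge0 _)) //= ltey.
    by apply/eqP => Foo; apply: noo; exists n.
  have en : (0 < e / (2 ^ n.+1)%:R)%R by rewrite divr_gt0 // ltr0n expn_gt0.
  have [_ [u [Pu Fu] <-] /ltW lu] := lb_ereal_inf_adherent en fin.
  by exists u.
have wG p : 0 <= w (G p.1 p.2) by have [+ _ _] := PG p.1; move=> /(_ p.2) /w_ge0.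
(* A bijection from [nat] to [nat * nat] merges the covers of all [F n] into one sequence. *)
have /card_esym/card_set_bijP[f fb] := card_nat2.
apply: (@le_trans _ _ (\sum_(i <oo) w (G (f i).1 (f i).2))).
  apply: ereal_inf_lbound; exists (fun i => G (f i).1 (f i).2) => //; split.
    by move=> i; have [+ _ _] := PG (f i).1; apply.
  move=> x [n _ Fnx]; have [_ /(_ x Fnx)[m _ xm] _] := PG n.
  by have [_ _ /(_ (n, m) Logic.I)[i _ fi]] := fb; exists i => //; rewrite fi.
rewrite nneseries_esumT; last by move=> n; exact: wG.
rewrite -(reindex_esum _ _ f (fun p => w (G p.1 p.2)) fb).
rewrite (_ : [set: nat * nat] = [set: nat] `*`` (fun=> [set: nat]));
    last by rewrite predeqE.
rewrite -(esum_esum (a := fun i j => w (G i j)));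
    last by move=> i j _ _; exact: (wG (i, j)).
rewrite -nneseries_esumT; last by move=> n; apply: esum_ge0 => m _; exact: (wG (n, m)).
apply: lee_nneseries => [n _ _|n _]; first by apply: esum_ge0 => m _; exact: (wG (n, m)).
rewrite -nneseries_esumT; last by move=> m; exact: (wG (n, m)).
by have [] := PG n.
Qed.

(** The index [z] of weight zero pads the finite family to a sequence. *)
Lemma cover_outer_fin (z : I) (N : nat) (f : 'I_N -> I) (c : R) A : P z -> w z = 0 ->
  (0 <= c)%R -> (forall i, P (f i) /\ w (f i) <= c%:E) ->
  A `<=` [set x | exists i, cov (f i) x] -> cover_outer A <= (N%:R * c)%:E.
Proof.
move=> Pz wz c0 Pf Af.
pose u m := if insub m is Some i then f i else z.
apply: (@le_trans _ _ (\sum_(i <oo) w (u i))).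
  apply: ereal_inf_lbound; exists u => //; split.
    by move=> m; rewrite /u; case: insubP => [i _ _|_]; [exact: (Pf i).1|].
  move=> x /Af[i xi]; exists i => //; rewrite /u; case: insubP => [j _ ji|];
      last by rewrite ltn_ord.
  by rewrite (_ : j = i) //; apply: val_inj.
have wu m : 0 <= w (u m).
  by apply: w_ge0; rewrite /u; case: insubP => [i _ _|_]; [exact: (Pf i).1|].
rewrite (nneseries_split 0 N) // add0n eseries0 ?adde0; last first.
  by move=> m Nm _; rewrite /u insubF // ltnNge Nm.
rewrite big_mkord (le_trans (y := \sum_(i < N) c%:E)) //.
  by apply: lee_sum => i _; rewrite /u; case: insubP => [j _ _|_];
      [exact: (Pf j).2|rewrite wz lee_fin].
by rewrite sumEFin sumr_const card_ord mulr_natl.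
Qed.

(** Subadditivity bounds the value by the tail of a geometric series from [M] on, and [M] is as
    large as desired. *)
Lemma cover_outer_geometric_null (C q : R) A :
  (0 <= C)%R -> (0 <= q < 1)%R ->
  (forall M0, exists2 M, (M0 <= M)%N & exists2 F : nat -> set T, A `<=` \bigcup_m F m &
     forall m, cover_outer (F m) <= (C * q ^+ (M + m))%R%:E) ->
  cover_outer A = 0.
Proof.
move=> C0 q01 H; apply/eqP; rewrite eq_le cover_outer_ge0 andbT.
apply/lee_addgt0Pr => e e0; rewrite add0e.
have /andP[q0 q1] := q01.
have [M0 HM0] : exists M0, forall M, (M0 <= M)%N -> (C * q ^+ M / (1 - q) <= e)%R.
  have := cvg_geometric (C / (1 - q)) (_ : `|q| < 1)%R; rewrite ger0_norm // => /(_ q1).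
  move=> /cvgrPdist_le /(_ e e0) [M0 _ HM]; exists M0 => M /HM /=.
  by rewrite mulrAC sub0r normrN; apply: le_trans; exact: ler_norm.
have [M M0M [F AF FM]] := H M0.
rewrite (le_trans (le_cover_outer AF)) // (le_trans (cover_outer_bigcup _)) //.
apply: (@le_trans _ _ (\sum_(i <oo) (C * q ^+ M * q ^+ i)%:E)).
  apply: lee_nneseries => [i _ _|i _]; first exact: cover_outer_ge0.
  by rewrite -mulrA -exprD.
apply: le_trans (nneseries_geometric_le _ q01) _; first by rewrite mulr_ge0 // exprn_ge0.
by rewrite lee_fin HM0.
Qed.

(** Otherwise every piece stays below its share [c * (1 - q) * q ^+ m]; the shares add up to [c],
    against subadditivity. *)
Lemma cover_outer_pigeonhole (c q : R) A (F : nat -> set T) :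
  (0 <= c)%R -> (0 <= q < 1)%R -> c%:E < cover_outer A -> A `<=` \bigcup_m F m ->
  exists m, (c * (1 - q) * q ^+ m)%:E <= cover_outer (A `&` F m).
Proof.
move=> c0 q01 cA AF; apply: contrapT => /forallNP no.
suff : cover_outer A <= c%:E by rewrite leNgt cA.
have AE : A `<=` \bigcup_m (A `&` F m) by rewrite -setI_bigcupr => x Ax; split =>
    //; exact: AF.
rewrite (le_trans (le_cover_outer AE)) // (le_trans (cover_outer_bigcup _)) //.
have /andP[q0 q1] := q01.
apply: (@le_trans _ _ (\sum_(i <oo) (c * (1 - q) * q ^+ i)%:E)).
  apply: lee_nneseries => [i _ _|i _]; first exact: cover_outer_ge0.
  by have /negP := no i; rewrite -ltNge => /ltW.
apply: le_trans (nneseries_geometric_le _ q01) _;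
    first by rewrite mulr_ge0 // subr_ge0 ltW.
by rewrite mulfK // gt_eqF // subr_gt0.
Qed.

End CoverOuter.

(** * Hausdorff measures and dyadic scales *)

Section HalfPowers.
Variable R : realType.
Implicit Types (s x : R) (l : nat).

Lemma powR_expr2 s l : (2 ^+ l) `^ s = (2 `^ s) ^+ l :> R.
Proof. by rewrite -powR_mulrn // -powRrM mulrC powRrM powR_mulrn // powR_ge0. Qed.

Lemma powR_half s l : (2^-1 ^+ l) `^ s = (2 `^ s)^-1 ^+ l :> R.
Proof.
have /divr1_eq : (2^-1 ^+ l) `^ s / ((2 `^ s)^-1 ^+ l) = 1; last by [].
rewrite !exprVn invrK -powR_expr2 -powRM ?exprn_ge0 ?invr_ge0 //.
by rewrite mulVf ?powR1 // expf_neq0.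
Qed.

Lemma exists_half_lt x : 0 < x -> exists l, 2^-1 ^+ l < x.
Proof.
move=> x0; exists (Num.bound x^-1).
rewrite exprVn invf_plt ?posrE ?exprn_gt0 //.
exact: upper_nthrootP.
Qed.

Lemma half_le l m : (l <= m)%N -> 2^-1 ^+ m <= 2^-1 ^+ l :> R.
Proof. by move=> lm; rewrite ler_wiXn2l // invf_le1 // ler1n. Qed.

End HalfPowers.

Section HausdorffFacts.
Variables (R : realType) (n : nat).
Implicit Types (A U E : set 'rV[R]_n) (s t d : R).

Lemma diam_leP U d : reflect (forall x y, U x -> U y ->
    enorm (x - y) <= d) (diam U <= d%:E)%E.
Proof.
apply: (iffP ereal_supP) => [H x y Ux Uy|H _ [[x y] [Ux Uy] <-]].
  by rewrite -lee_fin; apply: H; exists (x, y).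
by rewrite lee_fin; exact: H.
Qed.

Lemma diam_ge0 U : U !=set0 -> (0 <= diam U)%E.
Proof.
move=> [x Ux]; apply: le_ereal_sup_tmp; exists (enorm (x - x))%:E; first by exists (x, x).
by rewrite lee_fin enorm_ge0.
Qed.

Lemma hausdorff_weight_ge0 s U : (0 <= hausdorff_weight s U)%E.
Proof. by rewrite /hausdorff_weight; case: ifP => // _; exact: poweR_ge0. Qed.

Lemma hausdorff_weight_le s U d : 0 <= s -> 0 <= d -> (diam U <= d%:E)%E ->
  (hausdorff_weight s U <= (d `^ s)%:E)%E.
Proof.
move=> s0 d0 Ud; rewrite /hausdorff_weight; case: eqVneq => [_|/set0P U0].
  by rewrite lee_fin powR_ge0.
have := diam_ge0 U0; rewrite -poweR_EFin => U1.
by rewrite gt0_ler_poweR // in_itv /= ?U1 ?lee_fin ?d0 leey.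
Qed.

Lemma hausdorff_weight_ge s U d : 0 <= s -> 0 <= d -> U !=set0 -> (d%:E <= diam U)%E ->
  ((d `^ s)%:E <= hausdorff_weight s U)%E.
Proof.
move=> s0 d0 U0 Ud; rewrite /hausdorff_weight.
have /set0P/negbTE -> := U0; have := diam_ge0 U0; rewrite -poweR_EFin => U1.
by rewrite gt0_ler_poweR // in_itv /= ?U1 ?lee_fin ?d0 leey.
Qed.

Lemma hausdorff_premeasureE s d A : hausdorff_premeasure s d A =
  cover_outer id (hausdorff_weight s) [set U | (diam U <= d%:E)%E] A.
Proof. by []. Qed.

Lemma hausdorff_measure_eq0 s A :
  hausdorff_measure s A = 0%E <-> forall d, 0 < d -> hausdorff_premeasure s d A = 0%E.
Proof.
have p0 d : (0 <= hausdorff_premeasure s d A)%E.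
  by rewrite hausdorff_premeasureE; apply: cover_outer_ge0 =>
      U _; exact: hausdorff_weight_ge0.
split=> H.
  move=> d d0; apply/eqP; rewrite eq_le p0 andbT -H.
  by apply: ereal_sup_ubound; exists d.
apply/eqP; rewrite eq_le; apply/andP; split.
  by apply/ereal_supP => _ [d d0 <-]; rewrite H.
by apply: le_ereal_sup_tmp; exists (hausdorff_premeasure s 1 A) => //; exists 1 => /=.
Qed.

Lemma hausdorff_measure_bigcup_eq0 s (F : nat -> set 'rV[R]_n) A :
  (forall i, hausdorff_measure s (F i) = 0%E) -> A `<=` \bigcup_i F i ->
  hausdorff_measure s A = 0%E.
Proof.
move=> F0 AF; apply/hausdorff_measure_eq0 => d d0.
have w0 U : [set U | (diam U <= d%:E)%E] U -> (0 <= hausdorff_weight s U)%E.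
  by move=> _; exact: hausdorff_weight_ge0.
rewrite hausdorff_premeasureE.
apply/eqP; rewrite eq_le; apply/andP; split; last exact: cover_outer_ge0.
apply: le_trans (le_cover_outer _ _ _ AF) _.
apply: le_trans (cover_outer_bigcup _ w0 _) _; rewrite eseries0 // => i _ _.
by have /hausdorff_measure_eq0/(_ d d0) := F0 i.
Qed.

(** The weights at scale [M + m] add up to a constant times the power [M + m] of the ratio of [q] to
    [powR 2 t], which is below 1; a large [M] also brings the diameters below any given bound. *)
Lemma hausdorff_null_of_counts (t C q D : R) A : 0 <= t -> 0 <= C -> 0 <= q -> 0 < D ->
  q < 2 `^ t ->
  (forall M0, exists2 M, (M0 <= M)%N & exists2 F : nat -> set 'rV[R]_n,
     A `<=` \bigcup_m F m & forall m, exists N (V : 'I_N -> set 'rV[R]_n),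
     [/\ F m `<=` [set x | exists i, V i x],
       forall i, (diam (V i) <= (D * 2^-1 ^+ (M + m))%:E)%E &
       N%:R <= C * q ^+ (M + m)]) ->
  hausdorff_measure t A = 0%E.
Proof.
move=> t0 C0 q0 D0 qt H; apply/hausdorff_measure_eq0 => d d0.
have w0 U : [set U | (diam U <= d%:E)%E] U -> (0 <= hausdorff_weight t U)%E.
  by move=> _; exact: hausdorff_weight_ge0.
have p0 : 0 < 2 `^ t :> R by exact: powR_gt0.
rewrite hausdorff_premeasureE; apply: (cover_outer_geometric_null w0
    (C := C * D `^ t) (q := q / 2 `^ t)).
- by rewrite mulr_ge0 // powR_ge0.
- by apply/andP; split; [rewrite divr_ge0 // ltW | rewrite ltr_pdivrMr // mul1r].
have [l /ltW lD] := exists_half_lt (divr_gt0 d0 D0).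
rewrite ler_pdivlMr // mulrC in lD.
move=> M0; have [M M0M [F AF FN]] := H (maxn M0 l).
exists M; first exact: leq_trans (leq_maxl _ _) M0M.
exists F => // m; have [N [V [FV VD NC]]] := FN m.
have e0 : 0 <= D * 2^-1 ^+ (M + m) by rewrite mulr_ge0 ?exprn_ge0 // ltW.
have dU : D * 2^-1 ^+ (M + m) <= d.
  apply: le_trans lD; rewrite ler_pM2l // half_le //.
  by rewrite (leq_trans _ (leq_addr _ _)) // (leq_trans _ M0M) // leq_maxr.
have := @cover_outer_fin R _ _ id (hausdorff_weight t) [set U |
    (diam U <= d%:E)%E] w0 set0 N V ((D * 2^-1 ^+ (M + m)) `^ t) (F m).
move=> /(_ _ _ (powR_ge0 _ _) _ FV) K; apply: le_trans (K _ _ _) _.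
- by apply/diam_leP.
- by rewrite /hausdorff_weight eqxx.
- move=> i; split; first by rewrite /= (le_trans (VD i)) // lee_fin.
  exact: hausdorff_weight_le.
rewrite lee_fin powRM ?exprn_ge0 ?invr_ge0 ?(ltW D0) // powR_half.
rewrite [leLHS](_ : _ = N%:R * (D `^ t / 2 `^ t ^+ (M + m))); last by rewrite exprVn.
rewrite [leRHS](_ : _ = C * q ^+ (M + m) * (D `^ t / 2 `^ t ^+ (M + m))); last first.
  by rewrite expr_div_n; ring.
by rewrite ler_wpM2r // divr_ge0 ?powR_ge0 // exprn_ge0 // ltW.
Qed.

End HausdorffFacts.

Lemma sum_uniq_le_nneseries (R : realType) (w : nat -> \bar R) (s : seq nat) :
  (forall i, (0 <= w i)%E) -> uniq s -> (\sum_(i <- s) w i <= \sum_(i <oo) w i)%E.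
Proof.
move=> w0 us; pose K := (\max_(i <- s) i).+1.
have sK : perm_eq s [seq i <- index_iota 0 K | i \in s].
  apply: uniq_perm => //; first by rewrite filter_uniq // iota_uniq.
  move=> i; rewrite mem_filter mem_index_iota /=; case: (boolP (i \in s)) => //= si.
  by rewrite /K ltnS leq_bigmax_seq.
rewrite (perm_big _ sK) big_filter /=.
apply: le_trans (nneseries_lim_ge (P := xpredT) K _) => //.
by rewrite big_mkcond; apply: lee_sum => i _; case: ifP.
Qed.

Section ScaleCover.
Variables (R : realType) (n : nat).
Implicit Types (U E : set 'rV[R]_n) (s : R).

(* A set of diameter 0 fits every scale; it is put at the scale of its own
   index i, so that each scale receives at most one of them. *)
Lemma choose_scale U (M i : nat) : (diam U <= (2^-1 ^+ M)%:E)%E ->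
  exists m, (diam U <= (2^-1 ^+ (M + m))%:E)%E /\
    (m = i \/ U !=set0 /\ ((2^-1 ^+ (M + m).+1)%:E <= diam U)%E).
Proof.
move=> UM; have [U0|U0] := leP (diam U) 0%E.
  by exists i; split; [rewrite (le_trans U0) // lee_fin exprn_ge0|left].
have Une : U !=set0.
  apply/set0P; apply: contraTneq U0 => ->; rewrite -leNgt.
  by apply/diam_leP.
case dE : (diam U) U0 UM => [d| |] //; rewrite lte_fin lee_fin => d0 dM.
have exm : exists m, 2^-1 ^+ (M + m).+1 < d.
  have [l ld] := exists_half_lt d0; exists l; apply: le_lt_trans ld.
  by rewrite half_le //; lia.
case: (ex_minnP exm) => m md mmin; exists m; rewrite !lee_fin; split;
    last by right; split => //; exact: ltW.
case: m md mmin => [|m] md mmin; first by rewrite addn0.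
by rewrite addnS leNgt; apply/negP => /mmin; rewrite ltnn.
Qed.

(** A cover of total weight at most 1 is sorted by scale. Sets of comparable diameter have
    comparable weight, which bounds their number; the summand 1 in the constant pays for the one set
    placed by its index. *)
Lemma hausdorff_null_scale_cover s E (M : nat) : 0 <= s -> hausdorff_measure s E = 0%E ->
  exists (N : nat -> nat) (U : forall m, 'I_(N m) -> set 'rV[R]_n),
  [/\ E `<=` \bigcup_m [set x | exists i, U m i x],
    forall m i x y, U m i x -> U m i y -> enorm (x - y) <= 2^-1 ^+ (M + m) &
    forall m, (N m)%:R <= (2 `^ s + 1) * (2 `^ s) ^+ (M + m)].
Proof.
move=> s0 /hausdorff_measure_eq0 /(_ (2^-1 ^+ M)); rewrite exprn_gt0 ?invr_gt0 // =>
    /(_ isT).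
rewrite hausdorff_premeasureE => E0.
have [u [uM Eu] u1] : exists2 u : nat -> set 'rV[R]_n, 
    (forall i, (diam (u i) <= (2^-1 ^+ M)%:E)%E) /\ E `<=` \bigcup_i u i &
    (\sum_(i <oo) hausdorff_weight s (u i) <= 1)%E.
  have fin : cover_outer id (hausdorff_weight s) [set U | (diam U <=
      (2^-1 ^+ M)%:E)%E] E \is a fin_num.
    by rewrite E0.
  have [_ [u uP <-] /ltW u1] := lb_ereal_inf_adherent ltr01 fin.
  by exists u => //; move: E0 u1; rewrite /cover_outer => ->; rewrite add0e.
have /choice[sc scP] i := choose_scale i (uM i).
pose L (m : nat) : R := (2 `^ s + 1) * (2 `^ s) ^+ (M + m).
have p1 : 1 <= 2 `^ s :> R by rewrite -[leLHS](powRr0 2) ler_powR // ler1n.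
have L0 m : 0 <= L m by rewrite mulr_ge0 ?exprn_ge0 ?addr_ge0 // powR_ge0.
have bnd m (l : seq nat) : scattered eq_op l -> (forall i, i \in l -> sc i = m) ->
    (size l)%:R <= L m.
  move=> [ul _] lm.
  (* The set of index [m] may be at scale [m] without any lower bound on its diameter. *)
  pose l' := rem m l.
  have ul' : uniq l' by exact: rem_uniq.
  have sl' : (size l <= (size l').+1)%N.
    by rewrite /l'; case: (boolP (m \in l)) => ml;
        [rewrite size_rem //; case: (size l)|rewrite rem_id].
  have wl' i : i \in l' -> ((((2 `^ s)^-1 ^+ (M +
      m).+1) : R)%:E <= hausdorff_weight s (u i))%E.
    rewrite mem_rem_uniq // inE => /andP[im /lm scm].
    have [_] := scP i; rewrite scm => -[mi|[u0 ud]]; first by rewrite mi eqxx in im.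
    by rewrite -powR_half; apply: hausdorff_weight_ge => //; rewrite exprn_ge0.
  have w1 : (\sum_(i <- l') hausdorff_weight s (u i) <= 1)%E.
    apply: le_trans u1; apply: sum_uniq_le_nneseries => // i; exact: hausdorff_weight_ge0.
  have : (size l')%:R * (2 `^ s)^-1 ^+ (M + m).+1 <= 1 :> R.
    rewrite -lee_fin; apply: le_trans w1.
    apply: (@le_trans _ _ (\sum_(i <- l') ((2 `^ s)^-1 ^+ (M + m).+1)%:E)%E).
      by rewrite sumEFin big_const_seq count_predT iter_addr_0 mulr_natl.
    by rewrite [leLHS]big_seq [leRHS]big_seq; apply: lee_sum.
  rewrite exprVn ler_pdivrMr ?exprn_gt0 ?mul1r ?powR_gt0 // => sl.
  apply: (@le_trans _ _ (size l').+1%:R); first by rewrite ler_nat.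
  rewrite -natr1 /L mulrDl mul1r -exprS lerD // exprn_ege1 //.
have /choice[l lP] m : exists l : seq nat, (size l)%:R <= L m /\ forall i, sc i = m ->
    i \in l.
  have [|l [sl lm ml]] := @maximal_scattered nat eq_op (@eqxx _)
      (@eq_sym _) [set i | sc i = m] (Num.truncn (L m)).
    by move=> l sl lm; rewrite truncn_ge_nat //; exact: bnd.
  exists l; split; first exact: bnd.
  by move=> i /ml[j jl /eqP ->].
(* What is known of [l m] is that it contains every index of scale [m]; the condition on [sc]
   provides the diameter bound. *)
exists (fun m => size (l m)), (fun m i =>
    [set x | u (nth 0%N (l m) i) x /\ sc (nth 0%N (l m) i) = m]); split.
- move=> x /Eu[i _ ux]; exists (sc i) => //=; have [_ /(_ i erefl) il] := lP (sc i).
  have ib : (index i (l (sc i)) < size (l (sc i)))%N by rewrite index_mem.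
  by exists (Ordinal ib); rewrite /= nth_index.
- move=> m i x y [ux scm] [uy _]; have [/diam_leP] := scP (nth 0%N (l m) i);
    rewrite scm => H _.
  exact: H.
- by move=> m; have [] := lP m.
Qed.

End ScaleCover.

(** * Lebesgue outer measure and separated samples *)

Section LebesgueFacts.
Variables (R : realType) (k : nat).
Implicit Types (A : set 'rV[R]_k.+1) (d : R).

Definition box_cover (u : 'rV[R]_k.+1 * 'rV[R]_k.+1) := cbox u.1 u.2.
Definition box_weight (u : 'rV[R]_k.+1 * 'rV[R]_k.+1) : \bar R :=
    (cbox_volume u.1 u.2)%:E.
Definition is_box (u : 'rV[R]_k.+1 * 'rV[R]_k.+1) : Prop :=
  forall j, u.1 ord0 j <= u.2 ord0 j.

Lemma lebesgue_outerE A :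
  lebesgue_outer A = cover_outer box_cover box_weight is_box A.
Proof. by []. Qed.

Lemma box_weight_ge0 u : is_box u -> (0 <= box_weight u)%E.
Proof. by move=> uP; rewrite lee_fin; apply: prodr_ge0 => j _; rewrite subr_ge0. Qed.

Lemma lebesgue_outer_close (N : nat) (f : 'I_N -> 'rV[R]_k.+1) d A : 0 <= d ->
  (forall x, A x -> exists i, boxclose d x (f i)) ->
  (lebesgue_outer A <= (N%:R * (2 * d) ^+ k.+1)%:E)%E.
Proof.
move=> d0 Af; rewrite lebesgue_outerE.
apply: (cover_outer_fin box_weight_ge0 (z := (0, 0)) (f := fun i =>
    (f i - const_mx d, f i + const_mx d))).
- by move=> j.
(* The dimension [k.+1] is positive, so the volume of the degenerate box has a zero factor. *)
- rewrite /box_weight /cbox_volume; congr EFin; rewrite big_ord_recl /=.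
  by rewrite !mxE subrr mul0r.
- by rewrite exprn_ge0 // mulr_ge0.
- move=> i; split; first by move=> j; rewrite !mxE lerD // ge0_cp.
  rewrite /box_weight /cbox_volume lee_fin (eq_bigr (fun=> 2 * d));
      last by move=> j _; rewrite !mxE; ring.
  by rewrite prodr_const card_ord.
- move=> x /Af[i /boxcloseP xi]; exists i => j; rewrite !mxE; have := xi j.
  by rewrite ler_distl => /andP[-> ->].
Qed.

(** A maximal separated list in [A]: boxes of side [2 * d] around its members cover [A], and no two
    members fall in the same [U i], because the parametrization is isometric. *)
Lemma separated_sample (n N : nat) (B : 'M[R]_(k.+1, n)) (a : 'rV[R]_n)
    (U : 'I_N -> set 'rV[R]_n) d A : 0 <= d -> B *m B^T = 1%:M ->
  (forall i y y', U i y -> U i y' -> enorm (y - y') <= d) ->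
  (forall v, A v -> exists i, U i (a + v *m B)) ->
  exists p (v : 'I_p -> 'rV[R]_k.+1), [/\ (p <= N)%N, forall i, A (v i),
    forall i j, boxclose d (v i) (v j) -> i = j &
    (lebesgue_outer A <= (p%:R * (2 * d) ^+ k.+1)%:E)%E].
Proof.
move=> d0 BB dU AU.
have bnd s : boxseparated d s -> (forall x, x \in s -> A x) -> (size s <= N)%N.
  move=> [us ss] sA.
  (* [None] is the default outside [s], as ['I_N] may be empty. *)
  have /choice[g gP] v : exists i : option 'I_N, v \in s ->
      if i is Some i then U i (a + v *m B) else False.
    case: (boolP (v \in s)) => [/sA /AU[i Ui]|_]; last by exists None.
    by exists (Some i).
  have gi : {in s &, injective g}.
    move=> v w vs ws gvw; apply: ss => //; apply/boxcloseP => j.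
    have := gP v vs; have := gP w ws; rewrite gvw; case: (g w) => // i Uw Uv.
    have := dU _ _ _ Uv Uw; rewrite opprD addrACA subrr add0r -mulmxBl enorm_isometry //.
    by apply: le_trans; have := coord_le_enorm (v - w) j; rewrite !mxE.
  have us' : uniq (map g s) by rewrite map_inj_in_uniq.
  rewrite -(size_map g) (@leq_trans (size (map Some (enum 'I_N)))) //; last first.
    by rewrite size_map -cardE card_ord.
  apply: uniq_leq_size => // o /mapP[v vs ->].
  by have := gP v vs; case: (g v) => // i _; rewrite map_f // mem_enum.
have [s [ss sA sm]] := maximal_scattered (boxclosexx d0) (@boxcloseC _ _ d) bnd.
exists (size s), (fun i => nth 0 s i); split.
- exact: bnd.
- by move=> i; apply: sA; rewrite mem_nth.
- move=> i j /ss.2; rewrite !mem_nth // => /(_ isT isT) /eqP.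
  by rewrite nth_uniq ?ss.1 // => /eqP /val_inj.
- apply: (lebesgue_outer_close (f := fun i : 'I_(size s) => nth 0 s i)) =>
    // x /sm[y ys xy].
  have ib : (index y s < size s)%N by rewrite index_mem.
  by exists (Ordinal ib); rewrite /= nth_index.
Qed.

End LebesgueFacts.

(** * Extension of a set along planes *)

Lemma bernoulli_ineq (R : realType) (h : R) (N : nat) : 0 <= h <= 1 ->
  1 - N%:R * h <= (1 - h) ^+ N.
Proof.
move=> /andP[h0 h1]; elim: N => [|N IH]; first by rewrite mul0r subr0 expr0.
rewrite exprS; apply: (@le_trans _ _ ((1 - h) * (1 - N%:R * h))); last first.
  by rewrite ler_wpM2l // subr_ge0.
rewrite -natr1; have : 0 <= N%:R * (h * h) by rewrite !mulr_ge0.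
lra.
Qed.

(** Provides the decay rate for the pigeonhole over scales. Above 1/2, its powers eventually
    dominate the diameters [2^-1 ^+ l]. *)
Lemma exists_power_gt (R : realType) (mu : R) (N : nat) : mu < 1 ->
  exists th : R, [/\ 2^-1 < th, th < 1 & mu < th ^+ N].
Proof.
move=> mu1; pose h := Num.min 4^-1 ((1 - mu) / (2 * N.+1%:R)).
have N0 : 0 < 2 * N.+1%:R :> R by rewrite mulr_gt0.
have h0 : 0 < h by rewrite lt_min invr_gt0 ltr0n divr_gt0 // subr_gt0.
have h4 : h <= 4^-1 by rewrite ge_min lexx.
have hN : h * (2 * N.+1%:R) <= 1 - mu by rewrite -ler_pdivlMr // ge_min lexx orbT.
exists (1 - h); split; [lra|lra|].
apply: lt_le_trans (bernoulli_ineq N _); last by apply/andP; split; lra.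
have : 0 <= N%:R * h by rewrite mulr_ge0 // ltW.
rewrite -natr1 in hN; lra.
Qed.

Lemma half_eventually_le (R : realType) (th K : R) : 2^-1 < th -> 0 < K ->
  exists M, forall l, (M <= l)%N -> 2^-1 ^+ l <= K * th ^+ l.
Proof.
move=> th2 K0; have th0 : 0 < th by apply: lt_trans th2; rewrite invr_gt0.
have q1 : `|2^-1 / th| < 1 by rewrite ger0_norm ?divr_ge0 ?(ltW th0) // ltr_pdivrMr //
    mul1r.
have /cvgrPdist_le/(_ K K0)[M _ HM] := cvg_geometric 1 q1; exists M => l /HM /=.
rewrite sub0r normrN mul1r ger0_norm; last by rewrite exprn_ge0 // divr_ge0 // ltW.
by rewrite expr_div_n ler_pdivrMr // exprn_gt0.
Qed.

Section Extension.
Variables (R : realType) (n k : nat).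
Implicit Types (E : set 'rV[R]_n) (b c s t : R).

Definition bounded_by b (v : 'rV[R]_k.+1) : Prop := forall j, `|v ord0 j| <= b.

(* The predicate m is a lower bound on the outer measure: a fixed constant when
   E is the given set, a geometrically decaying one when E is its part covered
   at a single scale. *)
Definition seen b (m : \bar R -> Prop) E (x : 'rV[R]_n) : Prop :=
  exists a (B : 'M[R]_(k.+1, n)) v,
  [/\ B *m B^T = 1%:M, x = a + v *m B, bounded_by b v &
      m (lebesgue_outer [set v | bounded_by b v /\ E (a + v *m B)])].

(** By pigeonhole each seen point is seen by the part of [E] at one scale; [few_rich_points] bounds
    a separated set of such points, and a maximal one gives the cover to which
    [hausdorff_null_of_counts] applies. *)
Lemma seen_null b c s t E : 1 <= b -> 0 < c -> c <= 1 -> 0 <= s -> 0 <= t ->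
  2 * s - k.+1%:R < t -> hausdorff_measure s E = 0%E ->
  hausdorff_measure t [set x | seen b (fun m => c%:E < m)%E E x] = 0%E.
Proof.
move=> b1 c0 c1 s0 t0 st E0.
pose S : R := 2 `^ s; pose W : R := 2 `^ t; pose P : R := 2 ^+ k.+1.
have S0 : 0 < S by exact: powR_gt0.
have W0 : 0 < W by exact: powR_gt0.
have P0 : 0 < P by rewrite exprn_gt0.
(* The left side is 2 to the power [2 * s - k.+1%:R - t]. Then [th] is taken so close to 1 that the
   loss of [th ^+ (n + 3)] per scale keeps [q] below [W]. *)
have mu1 : S ^+ 2 / (P * W) < 1.
  rewrite ltr_pdivrMr ?mulr_gt0 // mul1r /S /W /P -!powR_mulrn ?powR_ge0 // -powRrM
      -powRD; last by rewrite pnatr_eq0 implybT.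
  have : 0 < ln 2 :> R by rewrite ln_gt0 // ltr1n.
  move=> l2; rewrite /powR pnatr_eq0 /= ltr_expR ltr_pM2r //; lra.
have [th [th2 th1 muth]] := exists_power_gt (n + 3) mu1.
have th0 : 0 < th by apply: lt_trans th2; rewrite invr_gt0.
pose g := c * (1 - th); have g0 : 0 < g by rewrite mulr_gt0 // subr_gt0.
have g1 : g <= 1 by apply: mulr_ile1 => //; lra.
have b2 : 1 <= 2 * b by lra.
have [c' [C [c'0 c'1 C0 few]]] := few_rich_points n k b2.
have [M1 HM1] := half_eventually_le th2 (mulr_gt0 c'0 g0).
have gn0 : 0 < g ^+ (n + 3) by rewrite exprn_gt0.
have tn0 : 0 < th ^+ (n + 3) by rewrite exprn_gt0.
pose C2 := C * (S + 1) ^+ 2 / g ^+ (n + 3).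
pose q := S ^+ 2 / (P * th ^+ (n + 3)).
have C20 : 0 <= C2.
  by apply: divr_ge0; [apply: mulr_ge0; [exact: ltW|exact: sqr_ge0]|exact: ltW].
have q0 : 0 <= q.
  by apply: divr_ge0; [exact: sqr_ge0|apply: mulr_ge0; exact: ltW].
(* Using [n.+1] in place of [n] keeps the diameter constant positive when [n] is 0. *)
have n10 : 0 < 2 * n.+1%:R :> R by rewrite mulr_gt0.
apply: (hausdorff_null_of_counts t0 C20 q0 n10).
  rewrite ltr_pdivrMr; last exact: mulr_gt0.
  move: muth; rewrite ltr_pdivrMr; last exact: mulr_gt0.
  by rewrite [X in (_ < X) -> _](_ : _ = 2 `^ t * (P * th ^+ (n + 3))) // /W; ring.
move=> M0; pose M := maxn M0 M1; exists M; first exact: leq_maxl.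
have [N [U [EU dU NU]]] := hausdorff_null_scale_cover M s0 E0.
exists (fun m => [set x | seen b (fun e =>
    (g * th ^+ m)%:E <= e)%E [set y | exists i, U m i y] x]).
  move=> x [a [B [v [BB xE vb cA]]]].
  have th01 : 0 <= th < 1 by rewrite ltW.
  rewrite lebesgue_outerE in cA.
  have [|m gm] := cover_outer_pigeonhole (@box_weight_ge0 R k) (ltW c0) th01 cA
      (F := fun m => [set v | exists i, U m i (a + v *m B)]).
    by move=> w [_ /EU[m _ mU]]; exists m.
  exists m => //; exists a, B, v; split =>
      //; rewrite lebesgue_outerE; apply: le_trans gm _.
  by apply: le_cover_outer => w [[wb _] wU].
(* The exponent [l] weakens the pigeonhole bound, where it is [m], but makes the count geometric in
   [l]; [l] being at least [M1] gives [d <= c' * a]. *)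
move=> m; pose l := (M + m)%N; pose d : R := 2^-1 ^+ l; pose a := g * th ^+ l.
have d0 : 0 < d by rewrite exprn_gt0 // invr_gt0.
have a0 : 0 < a by rewrite mulr_gt0 // exprn_gt0.
have a1 : a <= 1.
  by apply: mulr_ile1; rewrite ?(ltW g0) ?exprn_ge0 ?exprn_ile1 ?(ltW th0) ?(ltW th1).
have dca : d <= c' * a.
  by rewrite /a mulrA; apply: HM1; rewrite (leq_trans (leq_maxr M0 M1)) // leq_addr.
set F := [set x | _].
have size_le (s' : seq 'rV[R]_n) : boxseparated d s' -> (forall x, x \in s' -> F x) ->
    (size s')%:R <= C2 * q ^+ l.
  move=> ss sF.
  have rich x : x \in s' -> exists p (v : 'I_p -> 'rV[R]_k.+1) (B : 'M[R]_(k.+1, n)),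
    [/\ B *m B^T = 1%:M, forall i j, boxclose d (v i) (v j) -> i = j,
     forall i e, `|v i ord0 e| <= 2 * b, forall j, exists i, U m i (x + v j *m B) &
     a <= p%:R * (2 * d) ^+ k.+1].
    move=> /sF[a' [B [v0 [BB xE v0b gA]]]].
    have [|p [v [_ vA sep pA]]] := separated_sample (B := B) (a := a') (U := U m)
        (A := [set v | bounded_by b v /\ [set y | exists i, U m i y] (a' +
        v *m B)]) (ltW d0) BB (dU m).
      by move=> v [].
    (* The sample is recentred at [x], whose parameter is [v0]; hence the bound [2 * b]. *)
    exists p, (fun i => v i - v0), B; split => //.
    - move=> i j /boxcloseP H; apply: sep; apply/boxcloseP => e; have := H e.
      by rewrite !mxE; congr (`|_| <= _); ring.
    - move=> i e; rewrite !mxE (le_trans (ler_normB _ _)) //.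
      have := (vA i).1 e; have := v0b e; lra.
    - move=> i; have [_ [j Uj]] := vA i; exists j.
      by rewrite xE mulmxBl addrA addrAC addrK.
    - have := le_trans gA pA; rewrite lee_fin; apply: le_trans.
      by rewrite ler_wpM2l ?(ltW g0) // ler_wiXn2l ?(ltW th0) ?(ltW th1) // leq_addl.
  have H := few d a (N m) (U m) s' d0 dca a1 (dU m) ss rich.
  have al0 : 0 < a ^+ (n + 3) by rewrite exprn_gt0.
  rewrite -(ler_pM2r al0); apply: le_trans H _.
  have N2 : (N m)%:R ^+ 2 <= ((S + 1) * S ^+ l) ^+ 2.
    by apply: lerXn2r (NU m); rewrite nnegrE // mulr_ge0 ?exprn_ge0 ?addr_ge0 // ltW.
  apply: (@le_trans _ _ (C * ((S + 1) * S ^+ l) ^+ 2 * d ^+ k.+1)).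
    by rewrite ler_wpM2r ?exprn_ge0 ?(ltW d0) // ler_wpM2l // ltW.
  rewrite le_eqVlt; apply/orP; left; apply/eqP.
  have dE : d ^+ k.+1 = (P ^+ l)^-1 by rewrite /d /P exprVn exprVn -!exprM mulnC.
  have aE : a ^+ (n + 3) = g ^+ (n + 3) * (th ^+ (n +
      3)) ^+ l by rewrite exprMn -!exprM mulnC.
  have qE : q ^+ l = (S ^+ l) ^+ 2 / (P ^+ l * (th ^+ (n + 3)) ^+ l).
    by rewrite /q expr_div_n [(P * _) ^+ l]exprMn; congr (_ / _); rewrite -!exprM mulnC.
  rewrite dE aE qE /C2; move: (lt0r_neq0 gn0) (lt0r_neq0 (exprn_gt0 l tn0)) (lt0r_neq0
      (exprn_gt0 l P0)).
  move: (g ^+ _) (_ ^+ l) (P ^+ l) (S ^+ l) => x y z w x0 y0 z0.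
  by field; rewrite x0 y0 z0.
have [|s' [ss sF smax]] := maximal_scattered (boxclosexx (ltW d0)) (@boxcloseC _ _ d)
    (A := F) (N := Num.truncn (C2 * q ^+ l)).
  by move=> s' ss sF; rewrite truncn_ge_nat ?size_le // mulr_ge0 // exprn_ge0.
exists (size s'), (fun i : 'I_(size s') => [set y | boxclose d y (nth 0 s' i)]); split.
- move=> x /smax[y ys xy].
  have ib : (index y s' < size s')%N by rewrite index_mem.
  by exists (Ordinal ib); rewrite /= nth_index.
- move=> i; apply/diam_leP => x y /boxcloseP xi /boxcloseP yi; rewrite -/l -/d.
  have : forall j, `|(x - y) ord0 j| <= 2 * d.
    move=> j; rewrite !mxE; have := xi j; have := yi j.
    rewrite distrC => h1 h2; have := ler_distD (nth 0 s' i ord0 j) (x ord0 j) (y ord0 j).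
    lra.
  move=> /enorm_le /le_trans; apply.
  rewrite [leRHS](_ : _ = n.+1%:R * (2 * d)); last by ring.
  by rewrite ler_wpM2r ?mulr_ge0 ?(ltW d0) // ler_nat.
- exact: size_le.
Qed.

(** If [s] were smaller, the sets of scale [l] would cover a part of the plane of measure at most a
    constant times [(S / P) ^+ l] with [S < P], and the whole trace would be null. *)
Lemma hausdorff_null_ge_dim s E (a : 'rV[R]_n) (B : 'M[R]_(k.+1, n)) :
  0 <= s -> hausdorff_measure s E = 0%E -> B *m B^T = 1%:M ->
  (0 < lebesgue_outer [set v | E (a + v *m B)%R])%E -> k.+1%:R <= s.
Proof.
move=> s0 E0 BB; rewrite leNgt; apply: contraPN => sk.
pose S : R := 2 `^ s; pose P : R := 2 ^+ k.+1.
have S0 : 0 < S by exact: powR_gt0.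
have P0 : 0 < P by rewrite exprn_gt0.
have SP : S < P.
  rewrite /S /P -powR_mulrn // /powR pnatr_eq0 /= ltr_expR ltr_pM2r //.
  by rewrite ln_gt0 // ltr1n.
rewrite lebesgue_outerE (cover_outer_geometric_null (@box_weight_ge0 R k)
    (C := (S + 1) * P) (q := S / P)) ?ltxx //.
- by apply: mulr_ge0; [apply: addr_ge0 => //|]; exact: ltW.
- by apply/andP; split; [apply: divr_ge0; exact: ltW|rewrite ltr_pdivrMr // mul1r].
move=> M; exists M => //; have [N [U [EU dU NU]]] := hausdorff_null_scale_cover M s0 E0.
exists (fun m => [set v | exists i, U m i (a + v *m B)]).
  by move=> v /EU[m _ mU]; exists m.
move=> m; have d0 : 0 <= 2^-1 ^+ (M + m) :> R by rewrite exprn_ge0.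
have [|p [v [pN _ _ pA]]] := separated_sample (B := B) (a := a) (U := U m)
    (A := [set v | exists i, U m i (a + v *m B)]) d0 BB (dU m).
  by [].
rewrite lebesgue_outerE in pA; apply: le_trans pA _; rewrite lee_fin.
apply: (@le_trans _ _ ((S + 1) * S ^+ (M + m) * (2 * 2^-1 ^+ (M + m)) ^+ k.+1)).
  rewrite ler_wpM2r ?exprn_ge0 ?mulr_ge0 //.
  by apply: le_trans (NU m); rewrite ler_nat.
rewrite le_eqVlt; apply/orP; left; apply/eqP.
rewrite exprMn -/P exprVn exprVn exprAC -/P expr_div_n; field.
by rewrite lt0r_neq0 // exprn_gt0.
Qed.

(** Bounded windows exhaust the plane, so one of them already carries positive measure. A single [j]
    then bounds the parameter of [x], the window and the reciprocal of the measure. *)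
Lemma plane_extension_seen E : plane_extension k.+1 E `<=`
  E `|` \bigcup_j [set x | seen j.+1%:R (fun m => (j.+1%:R^-1)%:E < m)%E E x].
Proof.
move=> x [Ex|[V [_ [a [B [BB rV [_ Vpos]]]]] Vx]]; [by left|right].
move: Vx; rewrite -rV => -[v0 _ xE].
pose A := [set v | E (a + v *m B)].
pose Ab (j : nat) := [set v | bounded_by j.+1%:R v /\ A v].
have bb v : exists j : nat, bounded_by j.+1%:R v.
  exists (Num.bound (enorm v)) => e; rewrite (le_trans (coord_le_enorm _ _)) //.
  by rewrite (le_trans (ltW (archi_boundP (enorm_ge0 _)))) // ler_nat.
have leA i j : (i <= j)%N -> Ab i `<=` Ab j.
  by move=> ij v [vb Av]; split => // e; rewrite (le_trans (vb e)) // ler_nat ltnS.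
have mono := fun A B => @le_cover_outer R _ _ (@box_cover R k) (@box_weight R k)
    (@is_box R k) A B.
have [j0 j0pos] : exists j, (0 < lebesgue_outer (Ab j))%E.
  apply: contrapT => /forallNP no; move: Vpos; apply/negP; rewrite -leNgt.
  have AE : plane_param a B @^-1` (V `&` E) `<=` \bigcup_j Ab j.
    by move=> v [_ Ev]; have [j jv] := bb v; exists j.
  rewrite lebesgue_outerE; apply: le_trans (mono _ _ AE) _.
  apply: le_trans (cover_outer_bigcup _ (@box_weight_ge0 R k) _) _.
  by rewrite eseries0 // => i _ _; apply/eqP; rewrite eq_le leNgt; apply/andP; split;
      [apply/negP; exact: no|apply: cover_outer_ge0 => u; exact: box_weight_ge0].
have [j1 v0b] := bb v0.
have [j2 j2A] : exists j : nat, ((j.+1%:R^-1)%:E < lebesgue_outer (Ab j0))%E.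
  case: (lebesgue_outer (Ab j0)) j0pos => [r| |] //; last by exists 0%N; rewrite ltry.
  rewrite lte_fin => r0; exists (Num.bound r^-1); rewrite lte_fin invf_plt ?posrE //.
  by rewrite (lt_trans (archi_boundP _)) ?invr_ge0 ?(ltW r0) // ltr_nat.
pose j := maxn j0 (maxn j1 j2); exists j => //; exists a, B, v0; split => //.
  by move=> e; rewrite (le_trans (v0b e)) // ler_nat ltnS /j; lia.
apply: (@le_lt_trans _ _ (j2.+1%:R^-1)%:E).
  by rewrite lee_fin lef_pV2 ?posrE // ler_nat ltnS /j; lia.
apply: lt_le_trans j2A _; rewrite !lebesgue_outerE; apply: mono.
by apply: leA; rewrite /j; lia.
Qed.

(** As the extension is proper, some plane meets [E] in positive measure, so [k.+1%:R <= s] and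
    hence [s < t]. This makes [t] nonnegative and [E] itself null for [t]; the added points come
    from [seen_null]. *)
Lemma hausdorff_null_plane_extension s t E : 0 <= s -> 2 * s - k.+1%:R < t ->
  hausdorff_measure s E = 0%E -> plane_extension k.+1 E <> E ->
  0 <= t /\ hausdorff_measure t (plane_extension k.+1 E) = 0%E.
Proof.
move=> s0 st E0 FE.
have ks : k.+1%:R <= s.
  have [V [kV [a [B [BB rV [_ Vpos]]]]]] : exists V, kplane k.+1 V /\ pos_measure_in
      k.+1 V (V `&` E).
    apply: contrapT => /forallNP no; apply: FE; apply/seteqP; split => x; last by left.
    by case=> // -[V /no].
  apply: (hausdorff_null_ge_dim (a := a) (B := B) s0 E0 BB); apply: lt_le_trans Vpos _.
  by rewrite !lebesgue_outerE; apply: le_cover_outer => v [].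
have t0 : 0 <= t by lra.
split => //.
apply: (@hausdorff_measure_bigcup_eq0 _ _ _ (fun i =>
    if i is j.+1 then [set x | seen j.+1%:R (fun m =>
    (j.+1%:R^-1)%:E < m)%E E x] else E)); last first.
  by move=> x /plane_extension_seen[Ex|[j _ xj]]; [exists 0%N|exists j.+1].
move=> [|j].
  have S1 : 1 <= 2 `^ s :> R by rewrite -[leLHS](powRr0 2) ler_powR // ler1n.
  apply: (@hausdorff_null_of_counts _ _ t (2 `^ s + 1) (2 `^ s) 1) => //; try lra.
    rewrite /powR pnatr_eq0 /= ltr_expR ltr_pM2r ?ln_gt0 ?ltr1n //; lra.
  move=> M; exists M => //; have [N [U [EU dU NU]]] := hausdorff_null_scale_cover M s0 E0.
  exists (fun m => [set x | exists i, U m i x]) => // m.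
  exists (N m), (U m); split => // i.
  by apply/diam_leP => x y xi yi; rewrite mul1r; exact: dU yi.
have j1 : 1 <= j.+1%:R :> R by rewrite ler1n.
by apply: (@seen_null j.+1%:R _ s) => //; rewrite invf_le1.
Qed.

End Extension.

Theorem theorem2 (R : realType) (n k : nat) (hk : (1 <= k)%N) (hkn : (k <= n)%N)
  (E F : set 'rV[R]_n) (hF : F = plane_extension k E) :
  E = F \/ (hausdorff_dim F <= 2%:E * hausdorff_dim E - k%:R%:E)%E.
Proof.
case: k hk hkn hF => // k _ _ ->.
have [->|/eqP FE] := eqVneq (plane_extension k.+1 E) E; [by left|right].
have dim_le (A : set 'rV[R]_n) t : 0 <= t -> hausdorff_measure t A = 0%E ->
    (hausdorff_dim A <= t%:E)%E.
  by move=> t0 A0; apply: ereal_inf_lbound; exists t.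
have : (0 <= hausdorff_dim E)%E.
  by apply: le_ereal_inf_tmp => _ [s [s0 _] <-]; rewrite lee_fin.
(* An infinite dimension of [E] makes the right side infinite. *)
case dE : (hausdorff_dim E) => [e| |] //;
    last by rewrite mulry gtr0_sg // mul1e addye ?leey.
move=> _; rewrite -EFinM -EFinB; apply/lee_addgt0Pr => h h0.
(* An exponent [s] below [e + h / 4] has [2 * s] below [2 * e + h]. *)
have h4 : 0 < h / 4 by rewrite divr_gt0.
have fin : hausdorff_dim E \is a fin_num by rewrite dE.
have [_ [s [s0 E0] <-]] := lb_ereal_inf_adherent h4 fin.
rewrite -/(hausdorff_dim E) dE -EFinD lte_fin => se.
have [|t0 F0] := @hausdorff_null_plane_extension _ _ k s (2 * e - k.+1%:R +
    h) E s0 _ E0 FE.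
  lra.
by rewrite -EFinD; exact: dim_le.
Qed.
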